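(* Let $X$ be a nonzero finite-dimensional real vector space and let $f:X\to\mathbb{R}$ be finite and convex. Let $E_f=\{(t,z)\in\mathbb{R}\times X: t\ge f(z)\}$, and for $a\in\mathbb{R}$, $b\in X^*$ let $\ell_{a,b}(t,z)=at+b(z)$. If $a<0$, then $\ell_{a,b}$ is unbounded below on $E_f$; the same holds when $a=0$ and $b\neq 0$; and the zero objective ($a=0$, $b=0$) attains its minimum on $E_f$ at every point of $E_f$. Assume now that $a>0$ and set $p:=-b/a\in X^*$. Then: (i) $E_f^\infty=\{(s,w)\in\mathbb{R}\times X: s\ge f^\infty(w)\}$. (ii) $\ell_{a,b}$ is copositive on $E_f^\infty$ if and only if $p\in\overline{\operatorname{dom} f^*}$. (iii) $\ell_{a,b}$ is bounded below on $E_f$ if and only if $p\in\operatorname{dom} f^*$; in that case $\inf_{E_f}\ell_{a,b}=-a f^*(p)$. (iv) The infimum of $\ell_{a,b}$ over $E_f$ is attained if and only if $p\in\operatorname{ran}\partial f=\operatorname{dom}\partial f^*$, and then the minimizers are exactly the points of $\{(f(z),z): z\in X,\ p\in\partial f(z)\}$. (v) If $p\in\operatorname{dom} f^*\setminus\operatorname{ran}\partial f$, then $\ell_{a,b}(E_f)=(-a f^*(p),\infty)$; if $p\in\operatorname{ran}\partial f$, then $\ell_{a,b}(E_f)=[-a f^*(p),\infty)$.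
   Context: $X^*$ is the dual space of $X$. The Fenchel conjugate is $f^*(p)=\sup_{z\in X}\{p(z)-f(z)\}\in\mathbb{R}\cup\{+\infty\}$, $p\in X^*$, and $\operatorname{dom} f^*=\{p: f^*(p)<+\infty\}$. The subdifferential is $\partial f(z)=\{p\in X^*: f(y)\ge f(z)+p(y-z)\ \forall y\in X\}$, $\operatorname{ran}\partial f=\bigcup_{z\in X}\partial f(z)$, and $\operatorname{dom}\partial f^*=\{p\in X^*:\partial f^*(p)\neq\emptyset\}$, where $\partial f^*(p)\subset X$ is the subdifferential of $f^*$ at $p$ (with $X^{**}$ identified with $X$). The recession function is $f^\infty(w)=\lim_{\lambda\to\infty}\frac{f(z+\lambda w)-f(z)}{\lambda}\in\mathbb{R}\cup\{+\infty\}$, which is independent of $z\in X$. For a nonempty closed convex set $C$ in a finite-dimensional space $Y$, the recession cone is $C^\infty=\{d\in Y: x+\lambda d\in C\ \forall x\in C,\ \forall\lambda\ge0\}$. A linear functional $c$ is copositive on $C^\infty$ if $c(d)\ge0$ for all $d\in C^\infty$. A bar denotes closure. *)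

(* Defs.v *)
From HB Require Import structures.
From mathcomp Require Import all_boot all_order all_algebra.
From mathcomp Require Import all_classical all_reals all_analysis.

Set Implicit Arguments.
Unset Strict Implicit.
Unset Printing Implicit Defensive.

Import Order.TTheory GRing.Theory Num.Theory.
Import numFieldNormedType.Exports.
Import VectorInternalTheory.

Local Open Scope classical_set_scope.
Local Open Scope ring_scope.

Section ConvexAnalysis.
Context {R : realType} {X : vectType R}.
Local Notation dual := 'Hom(X, R^o).
Implicit Types (f : X -> R) (p : dual) (z w : X).

Definition conjugate f p : \bar R := ereal_sup [set (p z - f z)%:E | z in setT].

Definition dom_conjugate f : set dual := [set p | conjugate f p < +oo]%E.

Definition subdiff f z : set dual :=
  [set p : dual | forall y, f z + p (y - z) <= f y].

Definition ran_subdiff f : set dual := \bigcup_z subdiff f z.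

(* The subdifferential of the conjugate at p, a subset of X: a point z stands
   for the functional q |-> q z on the dual. *)
Definition subdiff_conjugate f p : set X :=
  [set z | forall q : dual,
     (conjugate f p + ((q - p) z)%:E <= conjugate f q)%E].

Definition dom_subdiff_conjugate f : set dual :=
  [set p | subdiff_conjugate f p !=set0].

(* The limit does not depend on the base point z when f is convex; z is kept as
   an argument so that statements can quantify over it. *)
Definition recession f z w : \bar R :=
  lim ((((f (z + l *: w) - f z) / l)%:E) @[l --> +oo%R]).

Definition epigraph f : set (R^o * X) := [set y | f y.2 <= y.1].

Definition objective (a : R) (b : dual) (y : R^o * X) : R^o :=
  a * y.1 + b y.2.

Lemma objective_is_linear a b : linear (objective a b).
Proof.
move=> k u v; rewrite /objective /= linearP mulrDr.
by rewrite scalerDr addrACA -!scalerAr.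
Qed.

HB.instance Definition _ a b :=
  GRing.isLinear.Build R (R^o * X)%type R^o _ (objective a b)
    (objective_is_linear a b).

End ConvexAnalysis.

Section FiniteDimensional.
Context {R : realType} {Y : vectType R}.
Implicit Types (C : set Y) (c : {linear Y -> R^o}).

Definition recession_cone C : set Y :=
  [set d | forall x (l : R), C x -> 0 <= l -> C (x + l *: d)].

Definition copositive c C := forall d, C d -> 0 <= c d.

Definition minimizers c C : set Y :=
  [set y | C y /\ forall y', C y' -> c y <= c y'].

(* A vectType carries no topology: closure is taken for the usual topology of a
   finite-dimensional real space, transported from row vectors along the linear
   coordinate isomorphism v2r. *)
Definition fdclosure C : set Y := v2r @^-1` closure (v2r @` C).

End FiniteDimensional.

(* Main.v *)
(* Writing [p = - b / a], the objective is [a * (t - p z)] on the epigraph, so its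
   values, bounds and minimizers there are those of [z |-> f z - p z].  The one
   point that is not a reformulation is the comparison of the recession cone with
   [dom f^*].  It rests on the existence of subgradients, obtained by extending a
   dominated functional along a basis.  A subgradient at a far point of a ray
   shows that [(s, w)] is a recession direction of the epigraph iff [q w <= s] for
   all [q] in [dom f^*]; and a point outside the closure of [dom f^*] is separated
   from it by a subgradient of the distance to [dom f^*]. *)
Require Import Defs.
From HB Require Import structures.
From mathcomp Require Import all_boot all_order all_algebra.
From mathcomp Require Import all_classical all_reals all_analysis.
From mathcomp Require Import ring lra.

Set Implicit Arguments.
Unset Strict Implicit.
Unset Printing Implicit Defensive.

Import Order.TTheory GRing.Theory Num.Theory.
Import numFieldNormedType.Exports.
Import VectorInternalTheory.

Local Open Scope classical_set_scope.
Local Open Scope ring_scope.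

(** * Existence of subgradients of a finite convex function *)

Section Subgradients.
Context {R : realType}.

Lemma convex_functionP (X : lmodType R) (f : X -> R) :
  @convex_function R X setT f <->
  forall (t : R) x y, 0 <= t <= 1 ->
    f (t *: x + (1 - t) *: y) <= t * f x + (1 - t) * f y.
Proof.
split=> [f_cvx t x y /andP[t0 t1]|f_cvx t x y _ _].
  exact: (f_cvx (Itv01 t0 t1) x y (in_setT _) (in_setT _)).
by apply: f_cvx; rewrite ge0 le1.
Qed.

(* One step of the Hahn-Banach extension: [c] is the value at [v]. *)
Lemma dominated_extension (X : vectType R) (U : set X) (p : 'Hom(X, R^o))
    (h : X -> R) (v : X) :
  @convex_function R X setT h -> U 0 ->
  (forall (s t : R) x y, U x -> U y -> U (s *: x + t *: y)) ->
  (forall u, U u -> p u <= h u) ->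
  exists c : R, forall u (t : R), U u -> p u + t * c <= h (u + t *: v).
Proof.
move=> /convex_functionP h_cvx U0 U_lin p_le_h.
(* Negative multiples of [v] bound [c] from below, positive ones from above. The bounds are
   compatible because [v] cancels in the convex combination with weights [s / (s + t)] and
   [t / (s + t)]; the supremum of the lower bounds then serves as [c]. *)
have gap (s t : R) x y : 0 < s -> 0 < t -> U x -> U y ->
    (p x - h (x - s *: v)) / s <= (h (y + t *: v) - p y) / t.
  move=> s0 t0 Ux Uy; have st0 : 0 < s + t by exact: addr_gt0.
  have stE : 1 - s / (s + t) = t / (s + t).
    by rewrite -{1}(divff (lt0r_neq0 st0)) -mulrBl addrC addKr.
  have st01 : 0 <= s / (s + t) <= 1.
    by rewrite ler_pdivrMr// mul1r lerDl (ltW t0) divr_ge0// ltW.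
  have := h_cvx _ (y + t *: v) (x - s *: v) st01.
  rewrite stE !scalerDr scalerN !scalerA addrACA.
  rewrite (_ : _ *: v - _ *: v = 0) ?addr0; last first.
    by rewrite -scalerBl (_ : _ - _ = 0) ?scale0r//; ring.
  have := p_le_h _ (U_lin (s / (s + t)) (t / (s + t)) _ _ Uy Ux).
  rewrite linearD !linearZ /= => /le_trans/[apply].
  rewrite /GRing.scale/= ![_ / (s + t) * _]mulrAC -!mulrDl.
  rewrite ler_pM2r ?invr_gt0// => le_st.
  rewrite ler_pdivrMr// mulrAC ler_pdivlMr//.
  by lra.
pose S := [set (p st.1 - h (st.1 - st.2 *: v)) / st.2 |
             st in [set st : X * R | U st.1 /\ 0 < st.2]].
have S_sup : has_sup S.
  split; first by exists ((p 0 - h (0 - 1 *: v)) / 1), (0, 1).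
  exists ((h (0 + 1 *: v) - p 0) / 1) => _ [[x s] /= [Ux s0] <-].
  exact: gap.
exists (sup S) => u t Uu; have [t0|t0|<-] := ltgtP 0 t.
- have : sup S <= (h (u + t *: v) - p u) / t.
    apply: ge_sup; first by case: S_sup.
    by move=> _ [[x s] /= [Ux s0] <-]; exact: gap.
  by rewrite ler_pdivlMr// mulrC lerBrDl.
- have : (p u - h (u - (- t) *: v)) / - t <= sup S.
    apply: (sup_upper_bound S_sup); exists (u, - t) => //.
    by split; rewrite //= oppr_gt0.
  by rewrite ler_pdivrMr ?oppr_gt0// scaleNr opprK; lra.
- by rewrite mul0r addr0 scale0r addr0 p_le_h.
Qed.

Lemma linear_minorant (X : vectType R) (h : X -> R) :
  @convex_function R X setT h -> h 0 = 0 ->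
  exists p : 'Hom(X, R^o), forall x, p x <= h x.
Proof.
move=> h_cvx h0; set n := \dim {:X}; pose e := vbasis {:X}.
have e_free : free e := basis_free (vbasisP _).
(* The span of the first [k] basis vectors: [U 0] is zero, where [h 0 = 0] starts the induction, and
   [U n] is all of [X]. *)
pose U k := [set x : X | forall i : 'I_n, (k <= i)%N -> coord e i x = 0].
suff ext k : (k <= n)%N ->
    exists p : 'Hom(X, R^o), forall x, U k x -> p x <= h x.
  have [p ple] := ext n (leqnn n); exists p => x; apply: ple => i.
  by rewrite leqNgt ltn_ord.
elim: k => [_|k IHk kn].
  exists 0 => x Ux; rewrite lfunE /= (coord_vbasis (memvf x)) big1 ?h0// => i _.
  by rewrite Ux// scale0r.
have [p ple] := IHk (ltnW kn); pose ik := Ordinal kn; pose v := e`_ik.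
have [||c ple'] := @dominated_extension X (U k) p h v h_cvx _ _ ple.
- by move=> i _; rewrite linear0.
- by move=> s t x y Ux Uy i ki; rewrite linearP linearZ /= Ux// Uy// !mulr0 addr0.
pose chi : 'Hom(X, R^o) := linfun (coord e ik : X -> R^o).
have chiE x : chi x = coord e ik x by rewrite lfunE.
(* The coordinate [chi] vanishes on [U k] and is 1 at [v], so this agrees with [p] on [U k] and
   takes the value [c] at [v]. *)
exists (p + (c - p v) *: chi) => x Ux.
pose t := coord e ik x; pose u := x - t *: v.
have Uu : U k u.
  move=> i; rewrite /u linearB linearZ /= (coord_free ik i e_free : coord e i v = _) leq_eqVlt.
  move=> /predU1P[kE|ki].
    by rewrite (_ : i = ik) ?eqxx ?mulr1 ?subrr//; apply/val_inj/esym.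
  by rewrite Ux// (_ : ik == i = false) ?mulr0 ?subrr//; apply: ltn_eqF.
have := ple' u t Uu; rewrite subrK => /(le_trans _); apply.
rewrite !lfunE /= lfunE /= chiE -/t /u linearB linearZ /=.
by rewrite /GRing.scale/=; lra.
Qed.

(** The increment of [f] from [z] is convex and vanishes at 0; a linear minorant of it is a
    subgradient. *)
Lemma subdiff_neq0 (X : vectType R) (f : X -> R) (z : X) :
  @convex_function R X setT f -> subdiff f z !=set0.
Proof.
move=> /convex_functionP f_cvx.
have [||p ple] := @linear_minorant X (fun x => f (z + x) - f z).
- apply/convex_functionP => t x y t01.
  have := f_cvx t (z + x) (z + y) t01.
  rewrite !scalerDr addrACA -scalerDl subrKC scale1r; lra.
- by rewrite addr0 subrr.
- by exists p => y; have := ple (y - z); rewrite subrKC; lra.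
Qed.

End Subgradients.

(** * Approximation and separation for the finite-dimensional closure *)

Section Closure.
Context {R : realType} {Y : vectType R}.
Implicit Types (C : set Y) (phi : {linear Y -> R^o}).

Lemma fdclosureP C y :
  fdclosure C y <-> forall e : R, 0 < e -> exists2 c, C c & `|v2r y - v2r c| < e.
Proof.
split=> [yC e e0|yC B /nbhs_ballP[e e0 eB]].
  have [_ [[c Cc <-]]] := yC _ (nbhsx_ballx (v2r y) e e0).
  by rewrite mx_norm_ball; exists c.
have [c Cc yc] := yC e e0; exists (v2r c); split; first by exists c.
by apply: eB; rewrite mx_norm_ball.
Qed.

Lemma linear_approx_fdclosure C y phi (e : R) :
  fdclosure C y -> 0 < e -> exists2 c, C c & `|phi y - phi c| < e.
Proof.
(* [K] is a Lipschitz constant of [phi] for the maximum norm of the coordinates. Below, [K + 1]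
   replaces it as a divisor since [K] may be 0. *)
move=> yC e0; pose K : R := \sum_i `|phi (r2v (delta_mx 0 i))|.
have K0 : 0 <= K by exact: sumr_ge0.
have phiK x : `|phi x| <= `|v2r x| * K.
  rewrite -[in leLHS](v2rK x) [in leLHS](row_sum_delta (v2r x)) !linear_sum /=.
  apply: le_trans (ler_norm_sum _ _ _) _; rewrite mulr_sumr ler_sum// => i _.
  rewrite !linearZ /= normrM ler_wpM2r//.
  rewrite [leRHS]mx_normrE.
  exact: (le_bigmax _ (fun ij => `|v2r x ij.1 ij.2|) (0, i)).
have [|c Cc yc] := (fdclosureP C y).1 yC (e / (K + 1)).
  by rewrite divr_gt0// ltr_wpDl.
exists c => //; rewrite -linearB (le_lt_trans (phiK _))// linearB.
rewrite ltr_pdivlMr ?ltr_wpDl// in yc; apply: le_lt_trans yc.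
by rewrite ler_wpM2l// lerDl.
Qed.

(* A subgradient at [y] of the distance to [C] is the separating functional. *)
Lemma fdclosure_separation C y : C !=set0 ->
  (forall (t : R) c d, 0 <= t <= 1 -> C c -> C d -> C (t *: c + (1 - t) *: d)) ->
  ~ fdclosure C y ->
  exists (phi : 'Hom(Y, R^o)) (e : R), 0 < e /\ forall c, C c -> phi c + e <= phi y.
Proof.
move=> [c0 Cc0] C_cvx yC.
have [e e0 far] : exists2 e : R, 0 < e & forall c, C c -> e <= `|v2r (y - c)|.
  apply: contrapT => nfar; apply: yC; apply/fdclosureP => e e0.
  apply: contrapT => noc; apply: nfar; exists e => // c Cc.
  by rewrite leNgt; apply/negP => yc; apply: noc; exists c; rewrite -?linearB.
pose D x := [set `|v2r (x - c)| | c in C]; pose d x := inf (D x).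
have D_inf x : has_inf (D x).
  by split; [exists `|v2r (x - c0)|, c0|exists 0 => _ [c _ <-]].
have d_le x c : C c -> d x <= `|v2r (x - c)|.
  by move=> Cc; apply: ge_inf; [case: (D_inf x)|exists c].
have d0 c : C c -> d c <= 0.
  by move=> Cc; apply: le_trans (d_le c c Cc) _; rewrite subrr linear0 normr0.
have d_cvx : @convex_function R Y setT d.
  (* The infimum need not be known to be attained: points of [C] that are optimal up to [eps] are
     combined inside [C]. *)
  apply/convex_functionP => t x z /andP[t0 t1]; apply/ler_addgt0Pr => eps eps0.
  have [_ [c Cc <-] xc] := inf_adherent eps0 (D_inf x).
  have [_ [c' Cc' <-] zc] := inf_adherent eps0 (D_inf z).
  have t01 : 0 <= t <= 1 by rewrite t0.
  have := d_le (t *: x + (1 - t) *: z) _ (C_cvx t _ _ t01 Cc Cc').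
  rewrite opprD addrACA -!scalerBr linearD !linearZ /= => /le_trans; apply.
  rewrite (le_trans (ler_normD _ _))// !normrZ ger0_norm// ger0_norm ?subr_ge0//.
  rewrite -/(d x) -/(d z) in xc zc.
  have := ler_wpM2l t0 (ltW xc).
  have : 0 <= 1 - t by rewrite subr_ge0.
  move=> /ler_wpM2l /(_ _ _ (ltW zc)).
  set A := `|_|; set B := `|_|; lra.
have [phi phiP] := subdiff_neq0 y d_cvx.
(* The subgradient inequality at [c] gives [phi c - phi y <= d c - d y <= - e]. *)
exists phi, e; split=> // c Cc; have := phiP c; rewrite linearB.
have := d0 c Cc; have : e <= d y.
  by apply: lb_le_inf => [|_ [c' Cc' <-]]; [case: (D_inf y)|exact: far].
lra.
Qed.

End Closure.

(** * Identification of the bidual with the space *)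

Section Bidual.
Context {R : realType} {X : vectType R}.
Local Notation dual := 'Hom(X, R^o).

Definition evaluation (w : X) (q : dual) : R^o := q w.

Lemma evaluation_is_linear w : linear (evaluation w).
Proof. by move=> k p q; rewrite /evaluation !lfunE /= lfunE. Qed.

HB.instance Definition _ w :=
  GRing.isLinear.Build R dual R^o _ (evaluation w) (evaluation_is_linear w).

(** Expanding [q] in the dual basis [chi] shows which [w] represents [phi]. It turns a functional
    separating points of the dual into a direction in [X]. *)
Lemma bidual_evaluation (phi : 'Hom(dual, R^o)) :
  exists w, forall q, phi q = evaluation w q.
Proof.
pose e := vbasis {:X}.
pose chi i : dual := linfun (coord e i : X -> R^o).
exists (\sum_(i < \dim {:X}) phi (chi i) *: e`_i) => q.
have qE : q = \sum_(i < \dim {:X}) q e`_i *: chi i.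
  apply/lfunP => x; rewrite {1}(coord_vbasis (memvf x)) linear_sum sum_lfunE.
  apply: eq_bigr => i _; rewrite linearZ !lfunE /= lfunE /=. exact: mulrC.
rewrite [in LHS]qE /evaluation !linear_sum; apply: eq_bigr => i _.
by rewrite !linearZ; exact: mulrC.
Qed.

End Bidual.

(** * The conjugate, its domain and the recession function *)

Section Conjugate.
Context {R : realType} {X : vectType R} (f : X -> R).
Hypothesis f_cvx : @convex_function R X setT f.
Local Notation dual := 'Hom(X, R^o).
Implicit Types p q : dual.

Lemma conjugate_ge p z : ((p z - f z)%:E <= conjugate f p)%E.
Proof. by apply: ereal_sup_ubound; exists z. Qed.

Lemma conjugate_le p (c : R) :
  (forall z, p z - f z <= c) -> (conjugate f p <= c%:E)%E.
Proof. by move=> pc; apply: ge_ereal_sup => _ [z _ <-]; rewrite lee_fin. Qed.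

Lemma dom_conjugateP p :
  dom_conjugate f p <-> exists c : R, forall z, p z - f z <= c.
Proof.
split=> [|[c /conjugate_le]]; last by move/le_lt_trans; apply; rewrite ltry.
rewrite /dom_conjugate /=; case E : (conjugate f p) => [c| |] // _.
  by exists c => z; rewrite -lee_fin -E conjugate_ge.
by have := conjugate_ge p 0; rewrite E.
Qed.

Lemma conjugate_fin p : dom_conjugate f p -> exists2 c : R,
  conjugate f p = c%:E &
  (forall z, p z - f z <= c) /\ forall e, 0 < e -> exists z, c - e < p z - f z.
Proof.
rewrite /dom_conjugate /=; case E : (conjugate f p) => [c| |] // _.
  exists c => //; split=> [z|e e0]; first by rewrite -lee_fin -E conjugate_ge.
  apply: contrapT => noz; have : (conjugate f p <= (c - e)%:E)%E.
    by apply: conjugate_le => z; rewrite leNgt; apply/negP => ?; apply: noz; exists z.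
  by rewrite E lee_fin; lra.
by have := conjugate_ge p 0; rewrite E.
Qed.

Lemma subdiffE p z : subdiff f z p <-> forall y, p y - f y <= p z - f z.
Proof. by split=> pz y; have := pz y; rewrite linearB; lra. Qed.

Lemma conjugate_subdiff p z : subdiff f z p -> conjugate f p = (p z - f z)%:E.
Proof.
move=> /subdiffE pz; apply/eqP; rewrite eq_le conjugate_ge andbT.
exact: conjugate_le.
Qed.

Lemma subdiff_dom_conjugate p z : subdiff f z p -> dom_conjugate f p.
Proof. by move=> pz; rewrite /dom_conjugate /= (conjugate_subdiff pz) ltry. Qed.

Lemma subdiff_conjugateE p z : subdiff_conjugate f p z <-> subdiff f z p.
Proof.
split=> [pz|pz q]; last first.
  rewrite (conjugate_subdiff pz) -EFinD !lfunE /= lfunE /=.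
  by apply: le_trans (conjugate_ge q z); rewrite lee_fin; lra.
(* A subgradient [q] at [z] has conjugate value [q z - f z]. Testing the hypothesis at this [q]
   bounds the conjugate at [p] by [p z - f z], without the biconjugate theorem. *)
have [q qz] := subdiff_neq0 z f_cvx.
apply/subdiffE => y; have := le_trans _ (pz q).
move=> /(_ ((p y - f y) + (q - p) z)%:E); rewrite EFinD leeD2r ?conjugate_ge//.
rewrite (conjugate_subdiff qz) lee_fin !lfunE /= lfunE /= => /(_ isT); lra.
Qed.

Lemma dom_conjugate_convex (t : R) p q : 0 <= t <= 1 ->
  dom_conjugate f p -> dom_conjugate f q ->
  dom_conjugate f (t *: p + (1 - t) *: q).
Proof.
move=> /andP[t0 t1] /dom_conjugateP[c pc] /dom_conjugateP[d qd].
apply/dom_conjugateP; exists (t * c + (1 - t) * d) => z.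
rewrite !lfunE /= !lfunE /= /GRing.scale/=.
have s0 : 0 <= 1 - t by rewrite subr_ge0.
have := ler_wpM2l t0 (pc z); have := ler_wpM2l s0 (qd z); lra.
Qed.

(** If [q w] exceeded [s], then [q - f] would be unbounded above along the ray from [z]. *)
Lemma minorant_slope (z w : X) (s : R) q :
  (forall l : R, 0 <= l -> f (z + l *: w) <= f z + l * s) ->
  dom_conjugate f q -> q w <= s.
Proof.
move=> fs /dom_conjugateP[c qc]; rewrite leNgt; apply/negP => sq.
pose K := c + f z - q z.
have K0 : 0 <= K by have := qc z; rewrite /K; lra.
have qs0 : 0 < q w - s by rewrite subr_gt0.
(* At this [l] the lower bound for [q - f] on the ray equals [c + 1]. *)
pose l := (K + 1) / (q w - s).
have l0 : 0 <= l by apply: divr_ge0; lra.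
have lE : l * (q w - s) = K + 1 by rewrite divfK// gt_eqF.
have := qc (z + l *: w); have := fs _ l0.
rewrite linearD linearZ /= /GRing.scale/=.
by move: lE; rewrite mulrBr /K; lra.
Qed.

(* Apply the subgradient inequality at the far point [x + l *: w]. *)
Lemma slope_bound (w : X) (s : R) :
  (forall q, dom_conjugate f q -> q w <= s) ->
  forall x l, 0 <= l -> f (x + l *: w) <= f x + l * s.
Proof.
move=> qs x l l0; have [q qP] := subdiff_neq0 (x + l *: w) f_cvx.
have := qP x; have := ler_wpM2l l0 (qs _ (subdiff_dom_conjugate qP)).
by rewrite opprD addNKr linearN linearZ /= /GRing.scale/=; lra.
Qed.

(** The nearer point is the convex combination of [z + l *: w] and [z] with weight [k / l] on the
    former. *)
Lemma difference_quotient_le (z w : X) (k l : R) : 0 < k -> k <= l ->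
  (f (z + k *: w) - f z) / k <= (f (z + l *: w) - f z) / l.
Proof.
move=> k0 kl; have l0 := lt_le_trans k0 kl.
have kl01 : 0 <= k / l <= 1 by rewrite ler_pdivrMr// mul1r kl divr_ge0// ltW.
have /convex_functionP/(_ _ (z + l *: w) z kl01) := f_cvx.
rewrite scalerDr scalerA divfK ?gt_eqF// addrAC -scalerDl subrKC scale1r => fk.
by rewrite ler_pdivrMr// mulrAC -mulrA; lra.
Qed.

Lemma recession_le (z w : X) (s : R) : (recession f z w <= s%:E)%E <->
  forall l, 0 <= l -> f (z + l *: w) <= f z + l * s.
Proof.
pose g (l : R) := ((f (z + l *: w) - f z) / l)%:E.
(* Monotonicity of [g] is available for positive arguments only. Truncating at 1 gives a function
   monotone on the whole line with the same limit, which is therefore a supremum. *)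
pose g1 (l : R) := g (Num.max l 1).
have g_le k l : 0 < k -> k <= l -> (g k <= g l)%E.
  by move=> k0 kl; rewrite lee_fin difference_quotient_le.
have g1_nd : {homo g1 : k l / k <= l >-> (k <= l)%E}.
  move=> k l kl; apply: g_le; first by rewrite lt_max ltr01 orbT.
  by rewrite ge_max !le_max kl lexx orbT.
have gE : recession f z w = ereal_sup (range g1).
  apply/cvg_lim => //; apply: cvg_trans (nondecreasing_cvge g1_nd).
  apply: near_eq_cvg; near=> l.
  have l1 : 1 <= l by near: l; apply: nbhs_pinfty_ge; rewrite num_real.
  by rewrite /g1 max_l.
rewrite gE; split=> [gs l|fs]; last first.
  apply: ge_ereal_sup => _ [l _ <-]; rewrite /g1 lee_fin.
  have m0 : 0 < Num.max l 1 by rewrite lt_max ltr01 orbT.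
  by rewrite ler_pdivrMr// lerBlDl mulrC fs// ltW.
rewrite le_eqVlt => /predU1P[<-|l0]; first by rewrite scale0r mul0r !addr0.
have : (g l <= s%:E)%E.
  apply: le_trans gs; apply: le_trans (_ : g l <= g1 l)%E _.
    by apply: g_le => //; rewrite le_max lexx.
  by apply: ereal_sup_ubound; exists l.
by rewrite lee_fin ler_pdivrMr// lerBlDl mulrC.
Unshelve. all: by end_near. Qed.

(** In effect, the recession function is the support function of [dom_conjugate f]. For the first
    inclusion the ray from [(f 0, 0)] suffices. *)
Lemma recession_cone_epigraph :
  recession_cone (epigraph f) =
  [set y | forall q, dom_conjugate f q -> q y.2 <= y.1].
Proof.
apply/seteqP; split=> -[s w] /= sw.
  move=> q; apply: (@minorant_slope 0) => l l0.
  by have := sw (f 0, 0) l (lexx _) l0.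
move=> -[t x] l; rewrite /epigraph /= => fxt l0.
apply: le_trans (slope_bound sw x l0) _; rewrite /GRing.scale/=; lra.
Qed.

End Conjugate.

(** * Values, bounds and minimizers of the objective for positive [a] *)

Section Objective.
Context {R : realType} {X : vectType R} (f : X -> R).
Variables (a : R) (b p : 'Hom(X, R^o)).
Hypotheses (a_gt0 : 0 < a) (pE : p = a^-1 *: (- b)).

Lemma objectiveE y : objective a b y = a * (y.1 - p y.2).
Proof.
rewrite pE lfunE /= lfunE /= /objective mulrBr /GRing.scale/= mulrA.
by rewrite divff ?gt_eqF// mul1r opprK.
Qed.

(** Over a fixed [z] the epigraph is the ray from [f z] upwards, so the objective fills the
    half-line from [a * (f z - p z)]. *)
Lemma objective_imageP s :
  (objective a b @` epigraph f) s <-> exists z, - (s / a) <= p z - f z.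
Proof.
split=> [[[t z] ftz <-]|[z sz]].
  exists z; rewrite objectiveE mulrC mulKf ?gt_eqF//=.
  by move: ftz; rewrite /epigraph/=; lra.
exists (s / a + p z, z); first by rewrite /epigraph /=; lra.
by rewrite objectiveE /= addrK mulrC divfK ?gt_eqF.
Qed.

Lemma minimizers_objective : minimizers (objective a b) (epigraph f) =
  [set (f z, z) | z in [set z | subdiff f z p]].
Proof.
apply/seteqP; split=> [[t z] [/= ftz min_tz]|_ [z zp <-]].
  (* Comparison with graph points; the case [y = z] forces [t = f z]. *)
  have fz y : t - p z <= f y - p y.
    by have := min_tz (f y, y) (lexx _); rewrite !objectiveE ler_pM2l.
  have tE : t = f z by move: ftz (fz z); rewrite /epigraph/=; lra.
  by exists z; rewrite -?tE//=; apply/subdiffE => y; have := fz y; lra.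
split=> [|[t y]]; rewrite /epigraph//= => fyt.
rewrite !objectiveE ler_pM2l//=.
by have /subdiffE/(_ y) := zp; lra.
Qed.

Lemma has_lbound_objective :
  has_lbound (objective a b @` epigraph f) <-> dom_conjugate f p.
Proof.
split=> [[m lb_m]|/dom_conjugateP[c pc]].
  apply/dom_conjugateP; exists (- (m / a)) => z; rewrite lerNr ler_pdivrMr//.
  by apply: lb_m; apply/objective_imageP; exists z; rewrite mulfK ?gt_eqF// opprK.
exists (- c * a) => s /objective_imageP[z sz].
by rewrite -ler_pdivlMr// lerNl (le_trans sz).
Qed.

Lemma inf_objective (c : R) : (forall z, p z - f z <= c) ->
  (forall e, 0 < e -> exists z, c - e < p z - f z) ->
  inf (objective a b @` epigraph f) = - a * c.
Proof.
move=> pc c_sup; have mem z : (objective a b @` epigraph f) (- (p z - f z) * a).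
  by apply/objective_imageP; exists z; rewrite mulfK ?gt_eqF// opprK.
have lb : lbound (objective a b @` epigraph f) (- a * c).
  move=> s /objective_imageP[z sz].
  by rewrite mulNr mulrC -mulNr -ler_pdivlMr// lerNl (le_trans sz).
apply/eqP; rewrite eq_le; apply/andP; split; last first.
  by apply: lb_le_inf => //; exists (- (p 0 - f 0) * a).
apply/ler_addgt0Pr => e e0; have [|z cz] := c_sup (e / a); first exact: divr_gt0.
apply: le_trans (ge_inf _ (mem z)) _; first by exists (- a * c).
have := ltW cz; rewrite -(ler_pM2r a_gt0) mulrBl divfK ?gt_eqF//; lra.
Qed.

End Objective.

(** * Degenerate objectives, then the assertions for each sign of [a] *)

Lemma objective_unbounded (R : realType) (X : vectType R) (f : X -> R) (a : R)
    (b : 'Hom(X, R^o)) :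
  a < 0 \/ a = 0 /\ b != 0 -> ~ has_lbound (objective a b @` epigraph f).
Proof.
move=> ab [m lb_m].
have {}lb_m t z : f z <= t -> m <= a * t + b z.
  by move=> ftz; apply: lb_m; exists (t, z).
case: ab => [a0|[a0 b0]].
  (* At height [(m - 1) / a] over 0 the objective is [m - 1]; the maximum with [f 0] keeps the point
     in the epigraph and, as [a < 0], only lowers the value. *)
  have := lb_m (Num.max (f 0) ((m - 1) / a)) 0.
  rewrite le_max lexx linear0 addr0 => /(_ isT).
  have : a * Num.max (f 0) ((m - 1) / a) <= m - 1.
    rewrite -[leRHS](divfK (ltr0_neq0 a0)) mulrC ler_nM2r//.
    by rewrite le_max lexx orbT.
  lra.
have [z bz] : exists z, b z != 0.
  apply: contrapT => nz; move/negP: b0; apply; apply/eqP/lfunP => z.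
  by rewrite lfunE; apply/eqP; apply: contrapT => /negP bz; apply: nz; exists z.
have := lb_m (f (((m - 1) / b z) *: z)) (((m - 1) / b z) *: z) (lexx _).
by rewrite a0 mul0r add0r linearZ /= /GRing.scale/= divfK//; lra.
Qed.

Theorem theorem3p1 (R : realType) (X : vectType R)
    (X_neq0 : exists x : X, x != 0)
    (f : X -> R)
    (f_convex : @convex_function R X setT f)
    (a : R) (b : 'Hom(X, R^o)) :
  (a < 0 -> ~ has_lbound (objective a b @` epigraph f)) /\
  (a = 0 -> b != 0 -> ~ has_lbound (objective a b @` epigraph f)) /\
  (a = 0 -> b = 0 -> minimizers (objective a b) (epigraph f) = epigraph f) /\
  (0 < a -> forall p : 'Hom(X, R^o), p = a^-1 *: (- b) ->
    (forall z : X, recession_cone (epigraph f) =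
       [set y | (recession f z y.2 <= (y.1)%:E)%E]) /\
    (copositive (objective a b) (recession_cone (epigraph f)) <->
       fdclosure (dom_conjugate f) p) /\
    ((has_lbound (objective a b @` epigraph f) <-> dom_conjugate f p) /\
     (dom_conjugate f p ->
       (inf (objective a b @` epigraph f))%:E = (- a%:E * conjugate f p)%E)) /\
    (ran_subdiff f = dom_subdiff_conjugate f /\
     (minimizers (objective a b) (epigraph f) !=set0 <-> ran_subdiff f p) /\
     (ran_subdiff f p -> minimizers (objective a b) (epigraph f) =
       [set (f z, z) | z in [set z | subdiff f z p]])) /\
    ((dom_conjugate f `\` ran_subdiff f) p ->
       objective a b @` epigraph f =
         [set s : R | (- a%:E * conjugate f p < s%:E)%E]) /\
    (ran_subdiff f p ->
       objective a b @` epigraph f =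
         [set s : R | (- a%:E * conjugate f p <= s%:E)%E])).
Proof.
split; first by move=> a0; apply: objective_unbounded; left.
split; first by move=> a0 b0; apply: objective_unbounded; right.
split.
  move=> -> ->; apply/seteqP; split=> [y []//|y fy]; split=> // y' _.
  by rewrite /= /objective !mul0r !add0r !lfunE.
move=> a_gt0 p pE; split.
  (* The bound by [s] over [dom_conjugate f] does not mention [z], so the description holds for
     every base point. *)
  move=> z; rewrite recession_cone_epigraph//.
  apply/seteqP; split=> -[s w] /= sw.
    by apply/(recession_le f_convex) => l; exact: slope_bound.
  by move=> q; apply: (minorant_slope (z := z)); exact/(recession_le f_convex).
split.
  rewrite recession_cone_epigraph//; split=> [cop|p_cl [s w] /= sw]; last first.
    rewrite /= (objectiveE a_gt0 pE) pmulr_rge0// subr_ge0 /= leNgt.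
    apply/negP => sp.
    (* With tolerance [p w - s], the approximating [q] satisfies [q w > s], against [sw]. *)
    have [|q q_dom] := linear_approx_fdclosure (evaluation w) (e := p w - s) p_cl.
      by rewrite subr_gt0.
    by have := sw q q_dom; rewrite /evaluation ltr_norml => ? /andP[]; lra.
  apply: contrapT => p_cl.
  have dom_neq0 : dom_conjugate f !=set0.
    by have [q /subdiff_dom_conjugate ?] := subdiff_neq0 0 f_convex; exists q.
  have [phi [e [e0 sep]]] :=
    fdclosure_separation dom_neq0 (@dom_conjugate_convex _ _ f) p_cl.
  have [w phiE] := bidual_evaluation phi.
  (* Separation puts this direction in the recession cone, while the objective there is
     [- a * e < 0]. *)
  have := cop (p w - e, w); rewrite /= (objectiveE a_gt0 pE) pmulr_rge0//=.
  have sw q : dom_conjugate f q -> q w <= p w - e.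
    by move=> /sep; rewrite !phiE /evaluation; lra.
  by move=> /(_ sw); lra.
split.
  split; first exact: has_lbound_objective.
  by move=> /conjugate_fin[c -> [pc c_sup]]; rewrite (inf_objective a_gt0 pE pc).
rewrite (minimizers_objective f a_gt0 pE).
split.
  split.
    by apply/seteqP; split=> [q [z _ zq]|q [z zq]]; exists z => //;
      apply/(subdiff_conjugateE f_convex).
  by split=> //; split=> [[_ [z zp _]]|[z _ zp]]; [exists z|exists (f z, z), z].
split=> [[/conjugate_fin[c cE [pc c_sup]] p_ran]|[z _ zp]].
  rewrite cE; apply/seteqP; split=> s; rewrite /= -EFinM lte_fin => sP.
    have /(objective_imageP f a_gt0 pE)[z sz] := sP.
    rewrite mulNr mulrC -mulNr -ltr_pdivlMr// ltrNl.
    (* If the endpoint were a value, [z] would maximize [p - f], making [p] a subgradient at [z]. *)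
    rewrite lt_neqAle (le_trans sz)// andbT; apply/eqP => scE; apply: p_ran.
    by exists z => //; apply/subdiffE => y; rewrite -scE in pc; exact: le_trans sz.
  apply/(objective_imageP f a_gt0 pE).
  (* The tolerance is positive because [s > - a * c], and subtracting it from [c] leaves
     [- (s / a)]. *)
  have [|z cz] := c_sup (c + s / a); last by exists z; move: cz; lra.
  by rewrite -ltrBlDl sub0r ltr_pdivlMr// mulNr mulrC -mulNr.
rewrite (conjugate_subdiff zp); apply/seteqP; split=> s; rewrite /= -EFinM lee_fin => sP.
  have /(objective_imageP f a_gt0 pE)[y sy] := sP.
  rewrite mulNr mulrC -mulNr -ler_pdivlMr// lerNl (le_trans sy)//.
  by have /subdiffE := zp.
(* The vertical ray over the single point [z] already yields the whole closed half-line. *)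
apply/(objective_imageP f a_gt0 pE); exists z.
by rewrite lerNl ler_pdivlMr// mulNr mulrC -mulNr.
Qed.
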